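(* For an associative unital ring $R$, the following conditions are equivalent: (1) $R$ is a clean $UJ$-ring; (2) $R/J(R)$ is a Boolean ring and idempotents lift modulo $J(R)$; (3) $R$ is a $J$-clean $UJ$-ring; (4) $R$ is a $J$-clean ring.
   Context: $U(R)$ is the group of units and $J(R)$ the Jacobson radical of $R$; $R$ is a $UJ$-ring if $U(R)=1+J(R)$. An element $r\in R$ is clean (respectively $J$-clean) if there are an idempotent $e\in R$ and an element $t\in U(R)$ (respectively $t\in J(R)$) with $r=e+t$; no commutation of $e$ and $t$ is required. $R$ is clean (respectively $J$-clean) if each of its elements is clean (respectively $J$-clean). A ring is Boolean if all its elements are idempotent. Idempotents lift modulo $J(R)$ if for every idempotent $\bar a\in R/J(R)$ there is an idempotent $e\in R$ with $e+J(R)=\bar a$. *)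

(* Defs.v *)
From HB Require Import structures.
From mathcomp Require Import all_boot all_order all_algebra.
From mathcomp Require Import boolp classical_sets.

Set Implicit Arguments.
Unset Strict Implicit.
Unset Printing Implicit Defensive.

Import GRing.Theory.
Local Open Scope ring_scope.
Local Open Scope classical_set_scope.
Local Open Scope quotient_scope.

(* Associative unital rings are [pzRingType]s: not necessarily commutative, and
   the zero ring is allowed. *)

Section Elements.
Variable R : pzRingType.

Definition units : set R := [set u | exists v : R, u * v = 1 /\ v * u = 1].

Definition idempotent_elt (e : R) : Prop := e * e = e.

Definition boolean_ring : Prop := forall x : R, idempotent_elt x.

Definition left_ideal (I : set R) : Prop :=
  [/\ I 0, forall x y, I x -> I y -> I (x + y) & forall r x, I x -> I (r * x)].

Definition maximal_left_ideal (M : set R) : Prop :=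
  [/\ left_ideal M, M <> setT
    & forall K : set R, left_ideal K -> M `<=` K -> K = M \/ K = setT].

(* The empty intersection is the whole ring, so J(0) = 0 for the zero ring. *)
Definition jacobson : set R := \bigcap_(M in maximal_left_ideal) M.

Lemma left_idealN (I : set R) x : left_ideal I -> I x -> I (- x).
Proof. by case=> _ _ IM Ix; rewrite -mulN1r; apply: IM. Qed.

Lemma left_ideal1 (I : set R) : left_ideal I -> I 1 -> I = setT.
Proof.
case=> _ _ IM I1; apply/seteqP; split=> // x _.
by rewrite -[x]mulr1; apply: IM.
Qed.

Lemma maximal_left_ideal_colon (M : set R) r :
  maximal_left_ideal M -> ~ M r -> maximal_left_ideal [set y | M (y * r)].
Proof.
case=> Mid _ Mmax nMr; have [M0 MD MM] := Mid.
split.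
- split=> /= [|x y Mx My|s x Mx]; first by rewrite mul0r.
  + by rewrite mulrDl; apply: MD.
  + by rewrite -mulrA; apply: MM.
- by move=> eqT; apply: nMr; rewrite -[r]mul1r -/([set y | M (y * r)] 1) eqT.
move=> K Kid subK; have [_ KD KM] := Kid.
have [[k Kk nMk]|noK] := pselect (exists2 k, K k & ~ M (k * r)); last first.
  left; apply/seteqP; split=> // x Kx /=.
  by apply: contrapT => nMx; apply: noK; exists x.
right; apply: left_ideal1 => //.
pose L := [set z | exists m s, M m /\ z = m + s * (k * r)].
have Lid : left_ideal L.
  split=> [|_ _ [m [s [Mm ->]]] [n [t [Mn ->]]]|t _ [m [s [Mm ->]]]].
  - by exists 0, 0; rewrite mul0r addr0.
  - by exists (m + n), (s + t); split; [apply: MD | rewrite mulrDl addrACA].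
  - by exists (t * m), (t * s); split; [apply: MM | rewrite mulrDr mulrA].
have subL : M `<=` L by move=> m Mm; exists m, 0; rewrite mul0r addr0.
have [LM|LT] := Mmax L Lid subL.
  case: nMk; rewrite -LM; exists 0, 1.
  by rewrite add0r mul1r.
have : L r by rewrite LT.
case=> m [s [Mm def_r]].
have K1 : K (1 - s * k).
  by apply: subK => /=; rewrite mulrBl mul1r -mulrA {1}def_r addrK.
by rewrite -(subrK (s * k) 1); apply: KD => //; apply: KM.
Qed.

Lemma jacobson_left_ideal : left_ideal jacobson.
Proof.
split=> [M|x y Jx Jy M|r x Jx M] Mm; have [[M0 MD MM] _ _] := Mm => //.
- by apply: MD; [apply: Jx | apply: Jy].
- by apply: MM; apply: Jx.
Qed.

Lemma jacobsonMr x r : jacobson x -> jacobson (x * r).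
Proof.
move=> Jx M Mm; have [Mr|nMr] := pselect (M r).
  by case: Mm => -[_ _ MM] _ _; apply: MM.
exact: (Jx _ (maximal_left_ideal_colon Mm nMr)).
Qed.

Definition in_jacobson := fun x : R => `[< jacobson x >].

Lemma in_jacobson_zmod_closed : zmod_closed in_jacobson.
Proof.
have [J0 JD _] := jacobson_left_ideal.
split=> [|x y /asboolP Jx /asboolP Jy]; apply/asboolP => //.
by apply: JD => //; apply: (left_idealN jacobson_left_ideal Jy).
Qed.

HB.instance Definition _ :=
  GRing.isZmodClosed.Build R in_jacobson in_jacobson_zmod_closed.

Definition jacobson_subgroup : zmodClosed R :=
  GRing.ZmodClosed.clone R in_jacobson _.

End Elements.

(* The additive quotient R / J(R) is the library's; its ring quotients only
   cover commutative rings, so the multiplication is transported here. *)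
Definition quotJ (R : pzRingType) : Type := Quotient.quot (jacobson_subgroup R).

Section QuotientRing.
Variable R : pzRingType.

HB.instance Definition _ := GRing.Zmodule.on (quotJ R).

Definition piJ (x : R) : quotJ R := \pi_(Quotient.quot (jacobson_subgroup R)) x.

Definition reprJ (a : quotJ R) : R :=
  repr (a : Quotient.quot (jacobson_subgroup R)).

Definition quotJ_one : quotJ R := piJ 1.

Definition quotJ_mul (a b : quotJ R) : quotJ R := piJ (reprJ a * reprJ b).

Lemma reprJK a : piJ (reprJ a) = a.
Proof. exact: reprK. Qed.

Lemma piJ_eq x y : piJ x = piJ y <-> jacobson (x - y).
Proof.
split=> [/eqP|Jxy].
  by rewrite -Quotient.idealrBE => /asboolP.
by apply/eqP; rewrite -Quotient.idealrBE; apply/asboolP.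
Qed.

Lemma piJB : zmod_morphism piJ.
Proof. by move=> x y; rewrite /piJ raddfB. Qed.

HB.instance Definition _ := GRing.isZmodMorphism.Build R (quotJ R) piJ piJB.

Lemma piJM x y : piJ (x * y) = quotJ_mul (piJ x) (piJ y).
Proof.
set x' := reprJ (piJ x); set y' := reprJ (piJ y).
have [_ JD JM] := jacobson_left_ideal R.
have Jx : jacobson (x - x') by apply/piJ_eq; rewrite reprJK.
have Jy : jacobson (y - y') by apply/piJ_eq; rewrite reprJK.
apply/piJ_eq; rewrite -(subrK (x * y') (x * y)) -mulrBr -addrA -mulrBl.
by apply: JD; [apply: JM | apply: jacobsonMr].
Qed.

Lemma quotJ_mulA : associative quotJ_mul.
Proof.
by move=> a b c; rewrite -[a]reprJK -[b]reprJK -[c]reprJK -!piJM mulrA.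
Qed.

Lemma quotJ_mul1l : left_id quotJ_one quotJ_mul.
Proof. by move=> a; rewrite -[a]reprJK -piJM mul1r. Qed.

Lemma quotJ_mul1r : right_id quotJ_one quotJ_mul.
Proof. by move=> a; rewrite -[a]reprJK -piJM mulr1. Qed.

Lemma quotJ_mulDl : left_distributive quotJ_mul +%R.
Proof.
move=> a b c; rewrite -[a]reprJK -[b]reprJK -[c]reprJK.
by rewrite -raddfD -!piJM mulrDl raddfD.
Qed.

Lemma quotJ_mulDr : right_distributive quotJ_mul +%R.
Proof.
move=> a b c; rewrite -[a]reprJK -[b]reprJK -[c]reprJK.
by rewrite -raddfD -!piJM mulrDr raddfD.
Qed.

HB.instance Definition _ := GRing.Zmodule_isPzRing.Build (quotJ R)
  quotJ_mulA quotJ_mul1l quotJ_mul1r quotJ_mulDl quotJ_mulDr.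

Lemma piJ_monoid_morphism : monoid_morphism piJ.
Proof. by split=> // x y; rewrite piJM. Qed.

HB.instance Definition _ :=
  GRing.isMonoidMorphism.Build R (quotJ R) piJ piJ_monoid_morphism.

End QuotientRing.

Section Rings.
Variable R : pzRingType.

Definition UJ_ring : Prop := @units R = [set 1 + j | j in @jacobson R].

Definition clean_elt (r : R) : Prop :=
  exists e t : R, [/\ idempotent_elt e, units t & r = e + t].

Definition J_clean_elt (r : R) : Prop :=
  exists e t : R, [/\ idempotent_elt e, jacobson t & r = e + t].

Definition clean_ring : Prop := forall r : R, clean_elt r.

Definition J_clean_ring : Prop := forall r : R, J_clean_elt r.

Definition idempotents_lift_mod_jacobson : Prop :=
  forall a : quotJ R, idempotent_elt a ->
    exists e : R, idempotent_elt e /\ piJ e = a.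

End Rings.

(* Main.v *)
Require Import Defs.
From HB Require Import structures.
From mathcomp Require Import all_boot all_order all_algebra.
From mathcomp Require Import boolp classical_sets.

(** Adding [1] turns a J-clean decomposition into a clean one: [r = e + j] is
    the same as [r + 1 = e + (1 + j)].  When the units are exactly the elements
    [1 + j] with [j] in the radical, the shift by [1] thus makes J-clean and
    clean rings coincide ([J_clean_ringE]).

    On the other side, [r] is J-clean exactly when its class modulo [J(R)] is
    the class of an idempotent of [R], so that all of [R] is J-clean exactly
    when every class is idempotent and lifts ([J_clean_boolean_lift]).

    What links the two is that a Boolean ring has no unit but [1], so that if
    [R / J(R)] is Boolean then each unit of [R] is [1] modulo the radical
    ([boolean_quotJ_UJ]).  The converse inclusion, that [1 + J(R)] consists of
    units, holds in every ring ([units_1Djacobson]); it rests on the existence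
    of maximal left ideals ([maximal_left_ideal_exists]). *)

Set Implicit Arguments.
Unset Strict Implicit.
Unset Printing Implicit Defensive.

Import GRing.Theory.
Local Open Scope ring_scope.
Local Open Scope classical_set_scope.

(** Zorn's lemma for unions of chains.  The union of the empty chain is empty,
    hence not an ideal, so the chains consist of arbitrary sets [A] for which
    [L `|` A] is a proper left ideal. *)
Lemma maximal_left_ideal_exists (R : pzRingType) (L : set R) :
  left_ideal L -> ~ L 1 -> exists2 M, maximal_left_ideal M & L `<=` M.
Proof.
move=> Lid nL1; have [L0 LD LM] := Lid.
pose P := [set A : set R | left_ideal (L `|` A) /\ ~ (L `|` A) 1].
have [F FP Ftot|A [[Aid nA1] Amax]] := @Zorn_bigcup R P.
  have up X x : F X -> (L `|` X) x -> (L `|` \bigcup_(Y in F) Y) x.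
    by move=> FX [Lx|Xx]; [left | right; exists X].
  split; last first.
    by case=> // -[X FX X1]; case: (FP X FX) => _; apply; right.
  split=> [|x y|r x]; first by left.
  - case=> [Lx|[X FX Xx]] [Ly|[Y FY Yy]].
    + by left; apply: LD.
    + have [[_ YD _] _] := FP Y FY.
      by apply: (up Y) => //; apply: YD; [left | right].
    + have [[_ XD _] _] := FP X FX.
      by apply: (up X) => //; apply: XD; [right | left].
    (* the larger of [X] and [Y] gives an ideal containing both summands *)
    have [XY|YX] := Ftot X Y FX FY.
      have [[_ YD _] _] := FP Y FY.
      by apply: (up Y) => //; apply: YD; right => //; apply: XY.
    have [[_ XD _] _] := FP X FX.
    by apply: (up X) => //; apply: XD; right => //; apply: YX.
  case=> [Lx|[X FX Xx]]; first by left; apply: LM.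
  have [[_ _ XM] _] := FP X FX.
  by apply: (up X) => //; apply: XM; right.
exists (L `|` A); last by move=> x; left.
split=> // [eqT|K Kid subK]; first by apply: nA1; rewrite eqT.
have LK : L `|` K = K by apply: setUidr => x Lx; apply: subK; left.
have [K1|nK1] := pselect (K 1); first by right; apply: left_ideal1.
left; apply/seteqP; split=> // x Kx; apply: contrapT => nAx.
have AK : A `<` K.
  split=> [y Ay|KA]; first by apply: subK; right.
  by apply: nAx; right; apply: KA.
by apply: (Amax K AK); split; rewrite LK.
Qed.

(** A maximal left ideal containing [1 + j] would contain [j], hence [1]. *)
Lemma left_inverse_1Djacobson (R : pzRingType) (j : R) :
  jacobson j -> exists v, v * (1 + j) = 1.
Proof.
move=> Jj; pose L := [set z | exists r, z = r * (1 + j)].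
have Lid : left_ideal L.
  split=> [|_ _ [r ->] [s ->]|r _ [s ->]].
  - by exists 0; rewrite mul0r.
  - by exists (r + s); rewrite mulrDl.
  - by exists (r * s); rewrite mulrA.
have [[v v1]|nL1] := pselect (L 1); first by exists v.
have [M Mmax LM] := maximal_left_ideal_exists Lid nL1.
have [Mid MT _] := Mmax; have [_ MD _] := Mid; case: MT.
apply: left_ideal1 => //; rewrite -(addrK j 1); apply: MD.
  by apply: LM; exists 1; rewrite mul1r.
by apply: left_idealN => //; apply: Jj.
Qed.

(** The left inverse of [1 + j] is again of the form [1 + j'], so it has itself
    a left inverse, which can only be [1 + j]. *)
Lemma units_1Djacobson (R : pzRingType) (j : R) :
  jacobson j -> units (1 + j).
Proof.
move=> Jj; have [v v1] := left_inverse_1Djacobson Jj.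
have Jid := jacobson_left_ideal R; have [_ _ JM] := Jid.
have Jvj : jacobson (- (v * j)) := left_idealN Jid (JM _ _ Jj).
have [w] := left_inverse_1Djacobson Jvj.
have -> : 1 - v * j = v by rewrite -v1 mulrDr mulr1 addrK.
move=> w1; exists v; split=> //.
suff -> : 1 + j = w by [].
by rewrite -[RHS]mulr1 -[in RHS]v1 mulrA w1 mul1r.
Qed.

Lemma boolean_quotJ_UJ (R : pzRingType) : boolean_ring (quotJ R) -> UJ_ring R.
Proof.
move=> boolQ; apply/seteqP; split=> [u [v [uv _]]|_ [j Jj <-]]; last first.
  exact: units_1Djacobson.
exists (u - 1); last by rewrite addrC subrK.
apply/piJ_eq; rewrite rmorph1.
(* an invertible idempotent is [1] *)
have uv1 : piJ u * piJ v = 1 by rewrite -rmorphM uv rmorph1.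
by rewrite -[LHS]mulr1 -[in LHS]uv1 mulrA (boolQ (piJ u)) uv1.
Qed.

Lemma J_clean_eltE (R : pzRingType) (r : R) :
  J_clean_elt r <-> exists e : R, idempotent_elt e /\ piJ e = piJ r.
Proof.
split=> [[e [t [ee Jt ->]]]|[e [ee /esym/piJ_eq Jre]]].
  by exists e; split=> //; apply/esym/piJ_eq; rewrite addrC addKr.
by exists e, (r - e); split=> //; rewrite addrC subrK.
Qed.

Lemma J_clean_boolean_lift (R : pzRingType) :
  J_clean_ring R <->
  boolean_ring (quotJ R) /\ idempotents_lift_mod_jacobson R.
Proof.
split=> [Jclean|[boolQ lift] r]; last first.
  by apply/J_clean_eltE; apply: lift; apply: boolQ.
have lift (a : quotJ R) : exists e : R, idempotent_elt e /\ piJ e = a.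
  by rewrite -[a]reprJK; apply/J_clean_eltE.
split=> [a|a _] //.
by have [e [ee <-]] := lift a; rewrite /idempotent_elt -rmorphM ee.
Qed.

Lemma J_clean_eltD1 (R : pzRingType) (r : R) :
  UJ_ring R -> J_clean_elt r <-> clean_elt (r + 1).
Proof.
move=> UJ; split=> [[e [j [ee Jj ->]]]|[e [u [ee]]]].
  exists e, (1 + j); split=> //; first exact: units_1Djacobson.
  by rewrite addrAC addrA.
rewrite UJ => -[j Jj <-] /eqP.
by rewrite [1 + j]addrC addrA (inj_eq (addIr 1)) => /eqP ->; exists e, j.
Qed.

Lemma J_clean_ringE (R : pzRingType) :
  UJ_ring R -> J_clean_ring R <-> clean_ring R.
Proof.
move=> UJ; split=> [Jclean r|clean r]; last exact/J_clean_eltD1.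
by rewrite -(subrK 1 r); apply/J_clean_eltD1.
Qed.

Theorem theorem3p2 (R : pzRingType) :
  [<-> clean_ring R /\ UJ_ring R;
       boolean_ring (quotJ R) /\ idempotents_lift_mod_jacobson R;
       J_clean_ring R /\ UJ_ring R;
       J_clean_ring R].
Proof.
tfae=> [[clean UJ]|boolQ_lift|[]//|Jclean].
- by apply/J_clean_boolean_lift/J_clean_ringE.
- by split; [apply/J_clean_boolean_lift
             | apply: boolean_quotJ_UJ; case: boolQ_lift].
have [boolQ _] := (J_clean_boolean_lift R).1 Jclean.
by have UJ := boolean_quotJ_UJ boolQ; split=> //; apply/J_clean_ringE.
Qed.
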